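(* Let $\mathcal D=(V,E)$ be a directed acyclic graph on $V=\{1,\dots,p\}$ in a parent ordering, $U$ a symmetric positive definite $p\times p$ matrix and $\alpha\in\mathbb R^p$. Let $dL=\prod_{(i,j)\in E,\,i>j}dL_{ij}$ and $dD=\prod_{i=1}^pdD_{ii}$ denote the canonical Lebesgue measures on $\mathcal L_{\mathcal D}$ and $\mathbb R_+^p$. Then $$\int_{\Theta_{\mathcal D}}\exp\Big\{-\tfrac12\operatorname{tr}(LD^{-1}L^\top U)\Big\}\prod_{i=1}^pD_{ii}^{-\frac12\alpha_i}\,dL\,dD<\infty$$ if and only if $\alpha_i>pa_i+2$ for all $i=1,\dots,p$. Furthermore, in this case the value $z_{\mathcal D}(U,\alpha)$ of this integral is $$z_{\mathcal D}(U,\alpha)=\prod_{i=1}^p\frac{\Gamma\big(\frac{\alpha_i}2-\frac{pa_i}2-1\big)\,2^{\frac{\alpha_i}2-1}(\sqrt\pi)^{pa_i}\det(U_{\prec i\succ})^{\frac{\alpha_i}2-\frac{pa_i}2-\frac32}}{\det(U_{\preceq i\succeq})^{\frac{\alpha_i}2-\frac{pa_i}2-1}}.$$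
   Context: Parent ordering: every directed edge $i\to j$ satisfies $i>j$; for $i\ne j$, $(i,j)\in E$ means $i\to j$. $\mathrm{pa}(i)$ is the set of parents of $i$ (excluding $i$), $pa_i=|\mathrm{pa}(i)|$, $\mathrm{fa}(i)=\mathrm{pa}(i)\cup\{i\}$. $U_{\prec i\succ}$ and $U_{\preceq i\succeq}$ are the principal submatrices of $U$ indexed by $\mathrm{pa}(i)$ and $\mathrm{fa}(i)$; $\det(U_{\prec i\succ})=1$ if $\mathrm{pa}(i)=\emptyset$. $\mathcal L_{\mathcal D}$: real lower triangular $p\times p$ matrices with unit diagonal and $L_{ij}=0$ for $i\neq j$, $i\notin\mathrm{pa}(j)$. $\Theta_{\mathcal D}$: pairs $(D,L)$ with $D$ a $p\times p$ diagonal matrix with strictly positive diagonal and $L\in\mathcal L_{\mathcal D}$. *)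

(* Defs.v *)
From HB Require Import structures.
From mathcomp Require Import all_boot all_order all_algebra.
From mathcomp Require Import all_classical all_reals all_analysis.

Set Implicit Arguments.
Unset Strict Implicit.
Unset Printing Implicit Defensive.

Import Order.TTheory GRing.Theory Num.Theory.
Import numFieldNormedType.Exports.

Local Open Scope classical_set_scope.
Local Open Scope ring_scope.

Section gamma.
Variable R : realType.

(* Euler's integral; only meaningful for 0 < x *)
Definition Gamma (x : R) : R :=
  \int[@lebesgue_measure R]_(t in `]0, +oo[) (t `^ (x - 1) * expR (- t)).

End gamma.

Section lebesgue_tuple.
Variable R : realType.
Local Notation RT := (measurableTypeR R).

Definition cons_pair n (x : RT * n.-tuple RT) : n.+1.-tuple RT :=
  [tuple of x.1 :: x.2].

(* Lebesgue measure on R^n, as an iterated product of the one on R; R^0 is a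
   point of mass 1. See leb_sigma_finite and leb_box below. *)
Fixpoint leb n : set (n.-tuple RT) -> \bar R :=
  if n is m.+1 then
    pushforward (@lebesgue_measure R \x leb (n := m))%E (@cons_pair m)
  else \d_([tuple] : 0.-tuple RT).

Lemma measurable_cons_pair n : measurable_fun setT (@cons_pair n).
Proof. exact: measurable_cons. Qed.

Lemma leb_sigma_finite n :
  exists mu : {sigma_finite_measure set (n.-tuple RT) -> \bar R},
    leb (n := n) = mu :> (set _ -> _).
Proof.
elim: n => [|n [mu muE]] /=.
  by exists (\d_([tuple] : 0.-tuple RT)).
rewrite muE.
pose leb1 : {sigma_finite_measure set RT -> \bar R} := @lebesgue_measure R.
pose nu : {measure set (RT * n.-tuple RT)%type -> \bar R} :=
  (leb1 \x mu)%E.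
have [F TF Foo] : sigma_finite setT nu.
  have /sigma_finiteP[F [TF ndF Foo]] := sigma_finiteT leb1.
  have /sigma_finiteP[G [TG ndG Goo]] := sigma_finiteT mu.
  exists (fun n => F n `*` G n).
    rewrite -setXTT TF TG predeqE => -[x y]; split.
      move=> [/= [k _ Fkx] [m _ Gmy]]; exists (maxn k m) => //; split.
      - by move: x Fkx; exact/subsetPset/ndF/leq_maxl.
      - by move: y Gmy; exact/subsetPset/ndG/leq_maxr.
    by move=> [k _ []] /= ? ?; split; exists k.
  move=> k; have [mF Fk] := Foo k; have [mG Gk] := Goo k.
  split; first exact: measurableX.
  by rewrite /= product_measure1E// lte_mul_pinfty// ge0_fin_numE.
have mc := @measurable_cons_pair n.
pose pm0 : {measure set (n.+1.-tuple RT) -> \bar R} :=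
  pushforward nu (@cons_pair n).
pose pm := pm0 mc.
pose un (t : n.+1.-tuple RT) : RT * n.-tuple RT := (thead t, [tuple of behead t]).
have mun : measurable_fun setT un.
  apply/measurable_fun_pairP; split; last exact: measurable_behead.
  exact: measurable_tnth.
have unK : cancel (@cons_pair n) un.
  by move=> [x t]; rewrite /un theadE; congr pair; apply: val_inj.
have sf : sigma_finite setT (pushforward nu (@cons_pair n)).
  exists (fun k => un @^-1` F k).
    rewrite predeqE => t; split=> // _.
    have : setT (un t) by [].
    by rewrite TF => -[k _ Fk]; exists k.
  move=> k; have [mF Fk] := Foo k; split.
    by rewrite -[X in measurable X]setTI; exact: mun.
  rewrite /pushforward -comp_preimage (_ : un \o _ = id) ?preimage_id//.
  by apply/funext => x; exact: unK.
pose f : set (n.+1.-tuple RT) -> \bar R := pushforward nu (@cons_pair n).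
pose H0 := isMeasure.Build _ _ _ f
  (measure0 pm) (measure_ge0 pm) (@measure_semi_sigma_additive _ _ _ pm).
pose fm : {measure set (n.+1.-tuple RT) -> \bar R} := HB.pack f H0.
pose H1 := Measure_isSigmaFinite.Build _ _ _ fm sf.
pose smu : {sigma_finite_measure set (n.+1.-tuple RT) -> \bar R} :=
  HB.pack (Measure.sort fm) H1.
by exists smu.
Qed.

Section instances.
Variable n : nat.

Let leb0 : leb (n := n) set0 = 0%E.
Proof. by have [mu ->] := leb_sigma_finite n. Qed.

Let leb_ge0 A : (0 <= leb (n := n) A)%E.
Proof. by have [mu ->] := leb_sigma_finite n. Qed.

Let leb_semi_sigma_additive : semi_sigma_additive (leb (n := n)).
Proof.
by have [mu ->] := leb_sigma_finite n; exact: measure_semi_sigma_additive.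
Qed.

HB.instance Definition _ := isMeasure.Build _ _ _ (leb (n := n))
  leb0 leb_ge0 leb_semi_sigma_additive.

Let leb_sfin : sigma_finite setT (leb (n := n)).
Proof. by have [mu ->] := leb_sigma_finite n; exact: sigma_finiteT. Qed.

HB.instance Definition _ := Measure_isSigmaFinite.Build _ _ _ (leb (n := n)) leb_sfin.

End instances.

Lemma leb_box n (A : 'I_n -> set RT) : (forall i, measurable (A i)) ->
  leb [set t : n.-tuple RT | forall i, A i (tnth t i)] =
  (\prod_(i < n) lebesgue_measure (A i))%E.
Proof.
elim: n A => [|n IH] A mA.
  rewrite big_ord0 /= diracE mem_set//= => -[]//.
rewrite big_ord_recl -IH; last by move=> i; exact: mA.
rewrite /= /pushforward -product_measure1E//; last first.
  rewrite (_ : [set _ | _] =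
      \big[setI/setT]_(i < n) ((@tnth n RT)^~ i @^-1` A (lift ord0 i))).
    apply: bigsetI_measurable => i _.
    by rewrite -[X in measurable X]setTI; exact: measurable_tnth.
  rewrite -bigcap_seq; apply/seteqP; split=> t/= At i; first by move=> _; exact: At.
  by apply: At => /=; rewrite mem_index_enum.
congr (_ _); apply/seteqP; split=> [[x t]/= At|[x t]/= [Ax At] i].
  split=> [|i]; first by have := At ord0.
  by have := At (lift ord0 i); rewrite /cons_pair tnthS.
by case: (unliftP ord0 i) => [j|] -> //; rewrite /cons_pair tnthS.
Qed.

End lebesgue_tuple.

Section graphs.
Variable p : nat.
Implicit Types E : {set 'I_p * 'I_p}.

(* i -> j; possible loops (i, i) in E are not counted as directed edges *)
Definition edge E : rel 'I_p := fun i j => (i != j) && ((i, j) \in E).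

Definition acyclic E := forall c : seq 'I_p, c != [::] -> ~~ cycle (edge E) c.

Definition parent_ordering E := forall i j, edge E i j -> (j < i)%N.

Definition pa E (i : 'I_p) : {set 'I_p} := [set j | edge E j i].
Definition fa E (i : 'I_p) : {set 'I_p} := i |: pa E i.

(* index set of the free coordinates L_ij *)
Definition coords E : {set 'I_p * 'I_p} := [set e in E | (e.2 < e.1)%N].

End graphs.

Section cholesky.
Variables (R : realType) (p : nat).
Implicit Types (E : {set 'I_p * 'I_p}) (U L D : 'M[R]_p) (alpha : 'rV[R]_p).

Definition symposdef U :=
  U^T = U /\ forall x : 'cV[R]_p, x != 0 -> 0 < (x^T *m U *m x) 0 0.

Definition principal U (A : {set 'I_p}) : 'M[R]_#|A| :=
  mxsub (@enum_val _ (mem A)) (@enum_val _ (mem A)) U.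

Definition LD E : set 'M[R]_p := [set L |
  [/\ forall i j : 'I_p, (i < j)%N -> L i j = 0,
      forall i, L i i = 1 &
      forall i j, i != j -> i \notin pa E j -> L i j = 0]].

Definition Theta E : set ('M[R]_p * 'M[R]_p) := [set DL |
  [/\ is_diag_mx DL.1, forall i, 0 < DL.1 i i & LD E DL.2]].

Definition Lmx E (l : #|coords E|.-tuple (measurableTypeR R)) : 'M[R]_p :=
  \matrix_(i, j)
    if i == j then 1
    else if (i, j) \in coords E then nth 0 l (index (i, j) (enum (coords E)))
    else 0.

Definition Dmx (d : p.-tuple (measurableTypeR R)) : 'M[R]_p :=
  diag_mx (\row_i tnth d i).

Definition DLmx E
    (x : #|coords E|.-tuple (measurableTypeR R) * p.-tuple (measurableTypeR R))
  : 'M[R]_p * 'M[R]_p := (Dmx x.2, Lmx x.1).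

(* The coordinates (L_ij), (i, j) in E with i > j, and (D_ii) are a bijective
   parametrization of Theta; the measure dL dD is Lebesgue measure in these
   coordinates. *)
Lemma DLmx_bij E : parent_ordering E ->
  set_bij [set x | forall i, 0 < tnth x.2 i] (Theta E) (DLmx (E := E)).
Proof.
move=> pE; have coordsE i j : ((i, j) \in coords E) = (i \in pa E j).
  rewrite !inE/= /edge; apply/andP/andP => [[-> ji]|[ij ijE]].
    by split=> //; rewrite -val_eqE neq_ltn ji orbT.
  by split=> //; apply: pE; rewrite /edge ij.
split.
- move=> [l d]/= d0; split=> /=.
  + by apply/is_diag_mxP => i j ij; rewrite !mxE -val_eqE (negbTE ij).
  + by move=> i; rewrite !mxE eqxx mulr1n.
  split=> [i j ij|i|i j ij iNj]; rewrite ?mxE ?eqxx//.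
  + by rewrite -val_eqE ltn_eqF// inE/= (ltnNge j) (ltnW ij) andbF.
  + by rewrite (negbTE ij) coordsE (negbTE iNj).
- move=> [l d] [l' d'] _ _ [/matrixP dd' /matrixP ll']; congr pair.
    apply/eq_from_tnth => i; pose e := enum_val i.
    have eC : (e.1, e.2) \in coords E by rewrite -surjective_pairing enum_valP.
    have e12 : e.1 != e.2.
      by move: eC; rewrite inE -val_eqE neq_ltn => /andP[_ ->]; rewrite orbT.
    have ei : index (e.1, e.2) (enum (coords E)) = i.
      by rewrite -surjective_pairing /e (enum_val_nth e) index_uniq ?enum_uniq// -cardE.
    by have := ll' e.1 e.2; rewrite !mxE (negbTE e12) eC ei -!tnth_nth.
  by apply/eq_from_tnth => i; have := dd' i i; rewrite !mxE eqxx.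
- move=> [D L] [/= /is_diag_mxP Ddiag D0 [Ltri L1 L0]].
  exists (map_tuple (fun e => L e.1 e.2) (enum_tuple (coords E)),
          mktuple (fun i => D i i)) => /=.
    by move=> i; rewrite tnth_mktuple.
  congr pair; apply/matrixP => i j; rewrite !mxE.
    rewrite tnth_mktuple; have [->|ij] := eqVneq i j; first by rewrite mulr1n.
    by rewrite mulr0n Ddiag.
  have [->|ij] := eqVneq i j; first by rewrite L1.
  case: ifPn => [ijC|]; last by rewrite coordsE => ?; rewrite L0.
  by rewrite (nth_map (i, j)) ?index_mem ?mem_enum// nth_index ?mem_enum.
Qed.

Definition integrand U alpha (DL : 'M[R]_p * 'M[R]_p) : R :=
  expR (- (2^-1 * \tr (DL.2 *m invmx DL.1 *m DL.2^T *m U))) *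
  \prod_(i < p) (DL.1 i i) `^ (- (2^-1 * alpha 0 i)).

(* the integral of the density over Theta against dL dD, possibly +oo *)
Definition zint E U alpha : \bar R :=
  (\int[leb (n := #|coords E|) \x leb (n := p)]_(x in DLmx (E := E) @^-1` Theta E)
     (integrand U alpha (DLmx x))%:E)%E.

Definition zval E U alpha : R :=
  \prod_(i < p)
    (Gamma (alpha 0 i / 2 - #|pa E i|%:R / 2 - 1) * 2 `^ (alpha 0 i / 2 - 1) *
     Num.sqrt pi ^+ #|pa E i| *
     \det (principal U (pa E i)) `^ (alpha 0 i / 2 - #|pa E i|%:R / 2 - 3 / 2) /
     \det (principal U (fa E i)) `^ (alpha 0 i / 2 - #|pa E i|%:R / 2 - 1)).

End cholesky.

(* Main.v *)
Require Import Defs.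
From mathcomp Require Import all_boot all_order all_algebra.
From mathcomp Require Import all_classical all_reals all_analysis.
From mathcomp Require Import measurable_realfun.
From mathcomp Require Import perm ring lra.

Set Implicit Arguments.
Unset Strict Implicit.
Unset Printing Implicit Defensive.

Import Order.TTheory GRing.Theory Num.Theory.
Import numFieldNormedType.Exports.
Local Open Scope classical_set_scope.
Local Open Scope ring_scope.

(** The trace in the exponent decouples along the columns of L:
    tr (L D^-1 L^T U) is the sum over i of q_i / D_ii, where q_i is the value
    of the quadratic form U at the i-th column of L.  That column is 1 at i,
    free on pa(i) and 0 elsewhere, so q_i depends only on the coordinates L_ji
    with j in pa(i), and it is the form of the principal submatrix of U on
    fa(i) evaluated at (x, 1) with x ranging over R^pa_i.  By Tonelli the
    integral is therefore a product over i of integrals over x and D_ii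
    ([zint_prod]); the integrand is nonnegative, so this holds in [0, +oo]
    without any assumption on alpha.

    For fixed D_ii = d the integral over x is Gaussian ([lebint_gauss]): it
    equals (2 pi d)^(pa_i / 2) det(U_pa)^(-1/2) exp (- c / (2 d)), where
    c = det(U_fa) / det(U_pa) is the minimum of the form at (x, 1).  It is
    computed one variable at a time: completing the square in a variable
    replaces the matrix by its Schur complement, which divides both
    determinants by the same pivot.

    What remains is, up to a positive constant, the inverse-gamma integral
    of d^(- s - 1) exp (- b / d) over d > 0 with b = c / 2 and
    s = alpha_i / 2 - pa_i / 2 - 1.  The substitution d = b / t turns it into
    b^(- s) Gamma(s).  It converges at 0 for every s, and at infinity exactly
    when s > 0, that is when alpha_i > pa_i + 2.  As every factor is positive,
    one infinite factor makes the whole product infinite, which gives the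
    equivalence; multiplying the finite values gives the formula. *)

(** * Inverse-gamma integrals on the half-line *)

Section OneDim.
Context {R : realType}.
Implicit Types (a b s x : R).
Local Notation mu := (@lebesgue_measure R).

Lemma continuous_powR a x : 0 < x -> {for x, continuous (@powR R ^~ a)}.
Proof.
move=> x0; apply: differentiable_continuous; apply/derivable1_diffP.
by apply: derivable_powR; rewrite in_itv/= x0.
Qed.

Lemma is_derive_div b x : x != 0 -> is_derive x 1 (fun y => b / y) (- (b / x ^+ 2)).
Proof.
move=> x0.
have dV := @is_deriveV R id x 1 1 x0 (is_derive_id _ _).
apply: (is_derive_eq (is_deriveZ b dV)).
by rewrite /GRing.scale/= mulr1 mulrN.
Qed.

Lemma continuous_div b x : x != 0 -> {for x, continuous (fun y : R => b / y)}.
Proof.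
by move=> x0; apply: cvgM; [exact: cvg_cst|apply: cvgV => //; exact: cvg_id].
Qed.

(** Division by zero gives 0, so the inverse is discontinuous but equals
    x * (x^2)^-1, and powers of nonnegative numbers are measurable. *)
Lemma measurable_invr : measurable_fun setT (@GRing.inv R).
Proof.
have -> : @GRing.inv R = fun x => x * (x ^+ 2) `^ (-1).
  apply/funext => x; rewrite powR_inv1 ?sqr_ge0//.
  have [->|x0] := eqVneq x 0; first by rewrite invr0 mul0r.
  by field.
apply: measurable_funM => //.
apply: (@measurableT_comp _ _ _ _ _ _ (@powR R ^~ (-1)) _ (fun x => x ^+ 2)).
  exact: measurable_powR.
exact: exprn_measurable.
Qed.

Definition gamma_fun s x := x `^ (s - 1) * expR (- x).

Definition invgamma_fun b s x := x `^ (- s - 1) * expR (- (b / x)).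

Lemma gamma_fun_ge0 s x : 0 <= gamma_fun s x.
Proof. by rewrite mulr_ge0 ?powR_ge0 ?expR_ge0. Qed.

Lemma invgamma_fun_ge0 b s x : 0 <= invgamma_fun b s x.
Proof. by rewrite mulr_ge0 ?powR_ge0 ?expR_ge0. Qed.

Lemma measurable_gamma_fun s : measurable_fun setT (gamma_fun s).
Proof.
apply: measurable_funM; first exact: measurable_powR.
by apply: measurableT_comp => //; exact: measurableT_comp.
Qed.

Lemma measurable_invgamma_fun b s D : measurable_fun D (invgamma_fun b s).
Proof.
apply: measurable_funTS; apply: measurable_funM; first exact: measurable_powR.
apply: measurableT_comp => //; apply: measurableT_comp => //.
by apply: measurable_funM => //; exact: measurable_invr.
Qed.

Lemma continuous_gamma_fun s x : 0 < x -> {for x, continuous (gamma_fun s)}.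
Proof.
move=> x0; apply: cvgM; first exact: continuous_powR.
apply: (@continuous_comp _ _ _ (fun x : R => - x) expR).
  by apply: cvgN; exact: cvg_id.
exact: continuous_expR.
Qed.

(** The change of variables t = b / x: its Jacobian is b / x^2. *)
Lemma gamma_fun_div b s x : 0 < b -> 0 < x ->
  gamma_fun s (b / x) * (b / x ^+ 2) = b `^ s * invgamma_fun b s x.
Proof.
move=> b0 x0; rewrite /gamma_fun /invgamma_fun.
have bn0 : b != 0 by rewrite gt_eqF.
have xn0 : x != 0 by rewrite gt_eqF.
have xi1 : x^-1 = x `^ (-1) by rewrite powR_inv1 ?ltW.
rewrite powRM ?invr_ge0 ?ltW// {1}xi1 -powRrM.
rewrite (_ : b `^ (s - 1) = b `^ s / b); last first.
  by rewrite powRB ?bn0 ?implybT// powRr1 ?ltW.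
rewrite (_ : -1 * (s - 1) = (- s - 1) + 2%:R); last by ring.
rewrite powRD ?xn0 ?implybT// powR_mulrn ?ltW//.
by field; rewrite bn0 xn0.
Qed.

(** The substitution is made on compact intervals that x |-> b / x exchanges,
    away from its singularity at 0; the half-line is reached by exhaustion. *)
Lemma integral_gamma_invgamma_itv b s n : 0 < b ->
  (\int[mu]_(x in `[(b / n.+1%:R)%R, (b / n.+1%:R^-1)%R]) (gamma_fun s x)%:E =
   \int[mu]_(x in `[n.+1%:R^-1%R, n.+1%:R%R]) (b `^ s * invgamma_fun b s x)%:E)%E.
Proof.
move=> b0.
have n0 : 0 < n.+1%:R^-1 :> R by rewrite invr_gt0.
have pos x : x \in `[(n.+1%:R^-1 : R), n.+1%:R] -> 0 < x.
  by rewrite in_itv/= => /andP[+ _]; exact: lt_le_trans.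
have posoo x : x \in `](n.+1%:R^-1 : R), n.+1%:R[ -> 0 < x.
  by rewrite in_itv/= => /andP[+ _]; exact: lt_trans.
pose F := fun y : R => b / y.
have dF x : 0 < x -> is_derive x 1 F (- (b / x ^+ 2)).
  by move=> x0; apply: is_derive_div; rewrite gt_eqF.
have F'E x : 0 < x -> (derive1 F) x = - (b / x ^+ 2).
  by move=> x0; rewrite derive1E; have [_ ->] := dF _ x0.
have cF x : 0 < x -> {for x, continuous F}.
  by move=> x0; apply: continuous_div; rewrite gt_eqF.
have cF' x : 0 < x -> {for x, continuous (derive1 F)}.
  move=> x0; have cG : {for x, continuous (fun y : R => - (b / y ^+ 2))}.
    apply: cvgN; apply: (@continuous_comp _ _ _ (fun y : R => y ^+ 2) (fun y => b / y)).
      exact: exprn_continuous.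
    by apply: continuous_div; rewrite expf_neq0 ?gt_eqF.
  rewrite /prop_for /continuous_at /= F'E//; apply: cvg_trans cG; apply: near_eq_cvg.
  near=> y; rewrite F'E//; near: y; exact: lt_nbhsr.
rewrite (@integration_by_substitution_decreasing _ F).
- apply: eq_integral => x /[!inE]/= /pos x0; rewrite /= !fctE F'E// opprK.
  by rewrite gamma_fun_div.
- by rewrite (@le_trans _ _ 1) ?ler1n// invf_le1 ?ler1n.
- move=> x y /pos x0 /pos y0 xy; rewrite /F ltr_pM2l// ltf_pV2 ?posrE//.
- by move=> x /posoo x0; exact: cF'.
- by apply/cvg_ex; exists ((derive1 F) n.+1%:R^-1); apply: cvg_at_right_filter; exact: cF'.
- by apply/cvg_ex; exists ((derive1 F) n.+1%:R); apply: cvg_at_left_filter; exact: cF'.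
- split.
  + by move=> x /posoo x0; have [] := dF _ x0.
  + by apply: cvg_at_right_filter; exact: cF.
  + by apply: cvg_at_left_filter; exact: cF.
- apply: continuous_in_subspaceT => x /[!inE]/=; rewrite in_itv/= => /andP[+ _] => h.
  by apply: continuous_gamma_fun; apply: lt_le_trans h; rewrite divr_gt0.
Unshelve. all: by end_near. Qed.

Lemma bigcup_itv_pos b : 0 < b ->
  \bigcup_n `[(b / n.+1%:R)%R, (b / n.+1%:R^-1)%R]%classic = `]0, +oo[%classic.
Proof.
move=> b0; apply/seteqP; split=> x /=.
  move=> [n _ /=]; rewrite !in_itv/= andbT => /andP[+ _].
  by apply: lt_le_trans; rewrite divr_gt0.
rewrite in_itv/= andbT => x0.
exists (maxn (Num.truncn (b / x)) (Num.truncn (x / b))) => //=.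
rewrite in_itv/= invrK; apply/andP; split.
  rewrite ler_pdivrMr// mulrC -ler_pdivrMr//.
  apply: (le_trans (ltW (truncnS_gt _))); rewrite ler_nat ltnS; exact: leq_maxl.
rewrite mulrC -ler_pdivrMr//.
apply: (le_trans (ltW (truncnS_gt _))); rewrite ler_nat ltnS; exact: leq_maxr.
Qed.

Lemma cvg_integral_itv_pos b (f : R -> R) : 0 < b -> measurable_fun setT f ->
  (forall x, 0 <= f x) ->
  ((\int[mu]_(x in `[(b / n.+1%:R)%R, (b / n.+1%:R^-1)%R]) (f x)%:E) @[n --> \oo]
  --> \int[mu]_(x in `]0%R, +oo[) (f x)%:E)%E.
Proof.
move=> b0 mf f0; rewrite -(bigcup_itv_pos b0).
apply: ge0_nondecreasing_set_cvg_integral.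
- move=> m n mn; apply/subsetPset => x /=; rewrite !in_itv/= => /andP[h1 h2].
  apply/andP; split.
    by apply: le_trans h1; rewrite ler_pM2l// lef_pV2 ?posrE// ler_nat.
  by apply: (le_trans h2); rewrite ler_pM2l// !invrK ler_nat.
- by [].
- by move=> n; apply/measurable_EFinP; exact: measurable_funTS.
- by move=> n x _; rewrite lee_fin.
Qed.

(** Monotone convergence makes the substitution valid in [0, +oo], hence also
    for s <= 0, where both sides are infinite. *)
Lemma integral_invgamma_gamma b s : 0 < b ->
  (\int[mu]_(x in `]0%R, +oo[) (invgamma_fun b s x)%:E =
   (b `^ (- s))%:E * \int[mu]_(x in `]0%R, +oo[) (gamma_fun s x)%:E)%E.
Proof.
move=> b0.
have bs0 : b `^ s != 0 by rewrite gt_eqF// powR_gt0.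
have h : (\int[mu]_(x in `]0%R, +oo[) (gamma_fun s x)%:E =
          (b `^ s)%:E * \int[mu]_(x in `]0%R, +oo[) (invgamma_fun b s x)%:E)%E.
  rewrite -ge0_integralZl_EFin ?powR_ge0//; last 2 first.
  - by move=> x _; rewrite lee_fin invgamma_fun_ge0.
  - by apply/measurable_EFinP; exact: measurable_invgamma_fun.
  have := cvg_integral_itv_pos b0 (measurable_gamma_fun s) (gamma_fun_ge0 s).
  under eq_cvg do rewrite integral_gamma_invgamma_itv//.
  move=> h1.
  have m2 : measurable_fun setT (fun x => b `^ s * invgamma_fun b s x).
    by apply: measurable_funM => //; exact: measurable_invgamma_fun.
  have p2 x : 0 <= b `^ s * invgamma_fun b s x.
    by rewrite mulr_ge0 ?powR_ge0 ?invgamma_fun_ge0.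
  (* with b = 1 the exhausting intervals are the [1/(n+1), n+1] of the substitution *)
  have := @cvg_integral_itv_pos 1 _ ltr01 m2 p2.
  under eq_cvg do rewrite !mul1r invrK.
  move=> h2; by rewrite -(cvg_lim _ h1)// -(cvg_lim _ h2).
by rewrite h muleA -EFinM powRN mulVf// mul1e.
Qed.

(** On [1, 2] the integrand is bounded below by a positive constant. *)
Lemma integral_invgamma_gt0 b s : 0 < b ->
  (0 < \int[mu]_(x in `]0%R, +oo[) (invgamma_fun b s x)%:E)%E.
Proof.
move=> b0.
pose c := expR (- (`|- s - 1| * ln 2)) * expR (- b).
have c0 : 0 < c by rewrite mulr_gt0 ?expR_gt0.
have lec x : x \in `[1%R, 2%R] -> c <= invgamma_fun b s x.
  rewrite in_itv/= => /andP[x1 x2]; have x0 : 0 < x := lt_le_trans ltr01 x1.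
  apply: ler_pM; rewrite ?expR_ge0//.
    rewrite /powR gt_eqF// ler_expR.
    apply: (@le_trans _ _ (- (`|- s - 1| * ln x))).
      rewrite lerN2 ler_wpM2l// ler_ln ?posrE//.
    rewrite -mulNr ler_wpM2r ?ln_ge0// lerNl -normrN; exact: ler_norm.
  by rewrite ler_expR lerN2 ler_pdivrMr// ler_pMr.
have mf D : measurable_fun D (fun x => (invgamma_fun b s x)%:E).
  by apply/measurable_EFinP; exact: measurable_invgamma_fun.
apply: (@lt_le_trans _ _ (\int[mu]_(x in `[1%R, 2%R]) c%:E)%E).
  rewrite integral_cst//= lebesgue_measure_itv/= lte_fin ltr1n/= -EFinD -EFinM.
  by rewrite lte_fin mulr_gt0// subr_gt0 ltr1n.
apply: (@le_trans _ _ (\int[mu]_(x in `[1%R, 2%R]) (invgamma_fun b s x)%:E)%E).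
  apply: ge0_le_integral => //.
  - by move=> x _; rewrite lee_fin ltW.
  - exact: mf.
apply: ge0_subset_integral => //; first exact: mf.
- by move=> x _; rewrite lee_fin invgamma_fun_ge0.
- by move=> x /=; rewrite !in_itv/= andbT => /andP[x1 _]; exact: lt_le_trans x1.
Qed.

(** The upper bound exp (n + 1) makes the logarithmic growth of the integral of
    1 / x explicit, so that no limit is needed to see that it diverges. *)
Lemma integral_inv n : (\int[mu]_(x in `[1%R, expR n.+1%:R]) (x^-1)%:E = n.+1%:R%:E)%E.
Proof.
have e1 : 1 < expR n.+1%:R :> R by rewrite expR_gt1.
have pos x : 1 <= x -> 0 < x :> R by exact: lt_le_trans.
rewrite (@continuous_FTC2 _ _ (@ln R))//.
- by rewrite ln1 expRK sube0.
- apply: continuous_in_subspaceT => x /[!inE]/=; rewrite in_itv/= => /andP[/pos x0 _].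
  by apply: cvgV; [rewrite gt_eqF|exact: cvg_id].
- split.
  + move=> x; rewrite in_itv/= => /andP[/ltW/pos x0 _].
    by have [] := is_derive1_ln x0.
  + by apply: cvg_at_right_filter; exact: continuous_ln.
  + by apply: cvg_at_left_filter; apply: continuous_ln; rewrite expR_gt0.
- move=> x; rewrite in_itv/= => /andP[/ltW/pos x0 _].
  by rewrite derive1E; have [_ ->] := is_derive1_ln x0.
Qed.

(** For s <= 0 and x >= 1 the integrand is at least exp (- b) / x. *)
Lemma integral_invgamma_infty b s : 0 < b -> s <= 0 ->
  (\int[mu]_(x in `]0%R, +oo[) (invgamma_fun b s x)%:E = +oo)%E.
Proof.
move=> b0 s0.
have mf D : measurable_fun D (fun x => (invgamma_fun b s x)%:E).
  by apply/measurable_EFinP; exact: measurable_invgamma_fun.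
have h n : ((expR (- b) * n.+1%:R)%:E <= \int[mu]_(x in `]0%R, +oo[) (invgamma_fun b s x)%:E)%E.
  rewrite EFinM -integral_inv.
  have m1 : measurable_fun `[1%R, expR n.+1%:R] (fun x : R => (x^-1)%:E).
    by apply/measurable_EFinP; apply: measurable_funTS; exact: measurable_invr.
  rewrite -ge0_integralZl_EFin ?expR_ge0//; last first.
    by move=> x /=; rewrite in_itv/= lee_fin invr_ge0 => /andP[x1 _]; exact: le_trans x1.
  apply: (@le_trans _ _ (\int[mu]_(x in `[1%R, expR n.+1%:R]) (invgamma_fun b s x)%:E)%E).
    apply: ge0_le_integral => //.
    - move=> x /=; rewrite in_itv/= => /andP[x1 _]; rewrite lee_fin.
      by rewrite mulr_ge0 ?expR_ge0// invr_ge0 (le_trans ler01).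
    - by apply: emeasurable_funM => //; exact: measurable_cst.
  - exact: mf.
    - move=> x /=; rewrite in_itv/= => /andP[x1 _]; rewrite lee_fin mulrC.
      have x0 : 0 < x := lt_le_trans ltr01 x1.
      apply: ler_pM; rewrite ?expR_ge0 ?invr_ge0//; first exact: ltW.
        have -> : x^-1 = x `^ (-1) by rewrite powR_inv1 ?ltW.
        by apply: (ler_powR x1); lra.
      by rewrite ler_expR lerN2 ler_pdivrMr// ler_pMr.
  apply: ge0_subset_integral => //; first exact: mf.
  - by move=> x _; rewrite lee_fin invgamma_fun_ge0.
  - by move=> x /=; rewrite !in_itv/= andbT => /andP[x1 _]; exact: lt_le_trans x1.
apply/eqyP => A A0.
apply: le_trans (h (Num.truncn (A / expR (- b)))); rewrite lee_fin.
by rewrite mulrC -ler_pdivrMr ?expR_gt0// ltW// truncnS_gt.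
Qed.

Lemma integral_powRN_itv1y s : 0 < s ->
  (\int[mu]_(x in `[1%R, +oo[) (x `^ (- s - 1))%:E = (s^-1)%:E)%E.
Proof.
move=> s0; have sn0 : s != 0 by rewrite gt_eqF.
pose F x : R := - s^-1 * x `^ (- s).
have dF x : 0 < x -> is_derive x 1 F (x `^ (- s - 1)).
  move=> x0; have h := is_derive1_powR (- s) x0.
  apply: (is_derive_eq (is_deriveZ (- s^-1) h)).
  by rewrite /GRing.scale/= mulrA mulrNN mulVf// mul1r.
have pos x : 1 <= x -> 0 < x :> R by exact: lt_le_trans.
have cF x : 0 < x -> {for x, continuous F}.
  by move=> x0; apply: differentiable_continuous; apply/derivable1_diffP; have [] := dF _ x0.
rewrite (@ge0_continuous_FTC2y _ _ F 1 0)//.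
- by rewrite /F powR1 sub0e -EFinN mulr1 opprK.
- by move=> x _; exact: powR_ge0.
- apply: continuous_in_subspaceT => x /[!inE]/=; rewrite in_itv/= andbT => /pos.
  exact: continuous_powR.
- rewrite -[X in _ --> X](mulr0 (- s^-1)); apply: cvgM; first exact: cvg_cst.
  apply/cvgrPdist_lt => e e0; near=> x.
  have x0 : 0 < x by [].
  rewrite sub0r normrN ger0_norm ?powR_ge0//.
  rewrite /powR gt_eqF// -[ltRHS](lnK e0) ltr_expR mulNr ltrNl.
  by rewrite mulrC -ltr_pdivrMr// -ltr_expR [ltRHS]lnK ?posrE.
- by move=> x /ltW/pos x0; have [] := dF _ x0.
- by apply: cvg_at_right_filter; exact: cF.
- move=> x; rewrite in_itv/= andbT => /ltW/pos x0.
  by rewrite derive1E; have [_ ->] := dF _ x0.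
Unshelve. all: by end_near. Qed.

(** Near 0 the exponential beats every power of x, so the integrand is bounded
    on ]0, 1]; on [1, +oo[ it is dominated by x^(- s - 1). *)
Lemma integral_invgamma_lty b s : 0 < b -> 0 < s ->
  (\int[mu]_(x in `]0%R, +oo[) (invgamma_fun b s x)%:E < +oo)%E.
Proof.
move=> b0 s0.
have mf D : measurable_fun D (fun x => (invgamma_fun b s x)%:E).
  by apply/measurable_EFinP; exact: measurable_invgamma_fun.
pose n := Num.truncn (s + 1).
have sn : s + 1 <= n.+1%:R by rewrite ltW// truncnS_gt.
pose C := (n.+1)`!%:R / b ^+ n.+1.
have C0 : 0 <= C by rewrite divr_ge0 ?exprn_ge0// ltW.
(* exp y >= y^(n+1) / (n+1)! at y = b / x, with n + 1 >= s + 1 *)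
have small x : x \in `]0, 1] -> invgamma_fun b s x <= C.
  rewrite in_itv/= => /andP[x0 x1].
  have bx0 : 0 < b / x by rewrite divr_gt0.
  have he : (b / x) ^+ n.+1 / (n.+1)`!%:R <= expR (b / x).
    by apply: le_trans (expR_ge1Dxn n (ltW bx0)); rewrite lerDr.
  have f0 : 0 < (n.+1)`!%:R :> R by rewrite ltr0n fact_gt0.
  have he' : expR (- (b / x)) <= C * x ^+ n.+1.
    have Cx0 : 0 < C * x ^+ n.+1 by rewrite mulr_gt0 ?divr_gt0 ?exprn_gt0.
    rewrite expRN -[leRHS]invrK lef_pV2 ?posrE ?expR_gt0 ?invr_gt0//.
    apply: le_trans he; rewrite le_eqVlt; apply/orP; left; apply/eqP.
    rewrite /C expr_div_n; field.
    by rewrite !expf_neq0 ?gt_eqF.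
  apply: (@le_trans _ _ (x `^ (- s - 1) * (C * x ^+ n.+1))).
    by rewrite ler_wpM2l ?powR_ge0.
  rewrite mulrCA ler_piMr// -powR_mulrn ?(ltW x0)// -powRD ?(gt_eqF x0) ?implybT//.
  by rewrite -[leRHS](powRr0 x); apply: ger_powR; rewrite ?x0//; lra.
have -> : `]0%R, +oo[%classic = `]0%R, 1%R] `|` `]1%R, +oo[ :> set R.
  by apply: itv_bndbnd_setU; rewrite bnd_simp.
rewrite ge0_integral_setU//; last 3 first.
- exact: mf.
- by move=> x _; rewrite lee_fin invgamma_fun_ge0.
- apply/disj_setPS => x /= []; rewrite !in_itv/= andbT => /andP[_ h1] h2.
  by have := le_lt_trans h1 h2; rewrite ltxx.
apply: lte_add_pinfty.
  apply: (@le_lt_trans _ _ (\int[mu]_(x in `]0%R, 1%R]) C%:E)%E).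
    apply: ge0_le_integral => //.
    + by move=> x _; rewrite lee_fin invgamma_fun_ge0.
    + exact: mf.
  by rewrite integral_cst//= lebesgue_measure_itv/= lte_fin ltr01/= -EFinD -EFinM ltry.
apply: (@le_lt_trans _ _ (\int[mu]_(x in `[1%R, +oo[) (x `^ (- s - 1))%:E)%E); last first.
  by rewrite integral_powRN_itv1y// ltry.
have mp D : measurable_fun D (fun x : R => (x `^ (- s - 1))%:E).
  by apply/measurable_EFinP; apply: measurable_funTS; exact: measurable_powR.
apply: (@le_trans _ _ (\int[mu]_(x in `[1%R, +oo[) (invgamma_fun b s x)%:E)%E).
  apply: ge0_subset_integral => //; first exact: mf.
    by move=> x _; rewrite lee_fin invgamma_fun_ge0.
  by move=> x /=; rewrite !in_itv/= !andbT => /ltW.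
apply: ge0_le_integral => //.
+ by move=> x _; rewrite lee_fin invgamma_fun_ge0.
+ exact: mf.
+ exact: mp.
+ move=> x /=; rewrite in_itv/= andbT => x1; rewrite lee_fin /invgamma_fun.
  rewrite ler_piMr ?powR_ge0// -[leRHS]expR0 ler_expR oppr_le0 divr_ge0// ltW//.
  exact: lt_le_trans x1.
Qed.

Lemma integral_invgamma b s : 0 < b -> 0 < s ->
  (\int[mu]_(x in `]0%R, +oo[) (invgamma_fun b s x)%:E = (b `^ (- s) * Gamma s)%:E)%E.
Proof.
move=> b0 s0; have := integral_invgamma_lty b0 s0; rewrite integral_invgamma_gamma//.
have bs0 : 0 < b `^ (- s) by rewrite powR_gt0.
rewrite EFinM => h; congr (_ * _)%E.
rewrite /Gamma /Rintegral fineK// ge0_fin_numE.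
  rewrite ltNge leye_eq; apply/negP => /eqP Ioo.
  by move: h; rewrite /gamma_fun Ioo gt0_muley ?lte_fin.
by apply: integral_ge0 => x _; rewrite lee_fin gamma_fun_ge0.
Qed.

End OneDim.

(** * Schur complements and determinants of positive definite forms *)

Section LinAlg.
Context {R : realType}.
Implicit Types (n : nat) (t : R).

Definition qform n (M : 'M[R]_n) (v : 'cV[R]_n) : R := (v^T *m M *m v) 0 0.

Lemma qformE n (M : 'M[R]_n) v :
  qform M v = \sum_i \sum_j v i 0 * M i j * v j 0.
Proof.
rewrite /qform !mxE exchange_big/=; apply: eq_bigr => j _.
by rewrite !mxE mulr_suml; apply: eq_bigr => i _; rewrite mxE.
Qed.

(** The Schur complement of the entry (0, 0), the pivot of the elimination of
    the first variable. *)
Definition schur n (M : 'M[R]_n.+1) : 'M[R]_n :=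
  \matrix_(i, j) (M (lift 0 i) (lift 0 j)
                  - M (lift 0 i) 0 * M 0 (lift 0 j) / M 0 0).

(** The principal submatrix without the last index: the last coordinate is the
    one that is set to 1 in the Gaussian integral, the others are integrated. *)
Definition leadmx n (M : 'M[R]_n.+1) : 'M[R]_n :=
  \matrix_(i, j) M (widen_ord (leqnSn n) i) (widen_ord (leqnSn n) j).

(** Eliminating the first variable and forgetting the last one commute, so the
    two determinants in the Gaussian integral lose the same pivot. *)
Lemma leadmx_schur n (M : 'M[R]_n.+2) : leadmx (schur M) = schur (leadmx M).
Proof.
have w0 : widen_ord (leqnSn n.+1) 0 = 0 by exact: val_inj.
have wl (i : 'I_n) : widen_ord (leqnSn n.+1) (lift 0 i) = lift 0 (widen_ord (leqnSn n) i).
  exact: val_inj.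
by apply/matrixP => i j; rewrite !mxE w0 !wl.
Qed.

(** Completing the square in the first variable. *)
Lemma qform_schur n (M : 'M[R]_n.+1) (v : 'cV[R]_n.+1) : M^T = M -> M 0 0 != 0 ->
  qform M v = M 0 0 * (v 0 0 + (\sum_j M 0 (lift 0 j) * v (lift 0 j) 0) / M 0 0) ^+ 2
              + qform (schur M) (\col_j v (lift 0 j) 0).
Proof.
move=> Msym M0; rewrite !qformE big_ord_recl big_ord_recl.
have sym i j : M i j = M j i by rewrite -[in LHS]Msym mxE.
set s := \sum_j M 0 (lift 0 j) * v (lift 0 j) 0.
have -> : \sum_(i < n) v 0 0 * M 0 (lift ord0 i) * v (lift ord0 i) 0 = v 0 0 * s.
  by rewrite mulr_sumr; apply: eq_bigr => j _; rewrite mulrA.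
under [in X in _ + X]eq_bigr do rewrite big_ord_recl.
rewrite big_split/=.
have -> : \sum_(i < n) v (lift ord0 i) 0 * M (lift ord0 i) ord0 * v ord0 0 = v 0 0 * s.
  by rewrite mulr_sumr; apply: eq_bigr => j _; rewrite [M _ ord0]sym mulrC [M _ _ * _]mulrC.
have -> : \sum_i \sum_j (\col_k v (lift 0 k) 0) i 0 * schur M i j * (\col_k v (lift 0 k) 0) j 0
  = \sum_(i < n) \sum_(j < n) v (lift 0 i) 0 * M (lift 0 i) (lift 0 j) * v (lift 0 j) 0
    - s * s / M 0 0.
  rewrite [s * s / M 0 0]mulrAC {1}/s [_ / M 0 0]mulr_suml mulr_suml -sumrB.
  apply: eq_bigr => i _; rewrite mulr_sumr -sumrB; apply: eq_bigr => j _.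
  by rewrite !mxE [M _ 0]sym; ring.
by rewrite -[ord0]/(0 : 'I_n.+1); field.
Qed.

(** Block LU factorization with the pivot M 0 0. *)
Lemma det_schur n (M : 'M[R]_n.+1) : M 0 0 != 0 -> \det M = M 0 0 * \det (schur M).
Proof.
move=> M0; pose N : 'M[R]_(1 + n) := M.
pose L : 'M[R]_(1 + n) := block_mx 1%:M 0 ((M 0 0)^-1 *: dlsubmx N) 1%:M.
pose T : 'M[R]_(1 + n) := block_mx (ulsubmx N) (ursubmx N) 0 (schur M).
have l0 (i : 'I_1) : lshift n i = 0 :> 'I_(1 + n) by rewrite ord1; exact: val_inj.
have r0 (i : 'I_n) : rshift 1 i = lift 0 i :> 'I_(1 + n) by exact: val_inj.
have NE : N = L *m T.
  rewrite /L /T mulmx_block !mul1mx !mul0mx !addr0 -[LHS]submxK.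
  congr block_mx.
    apply/matrixP => i j; rewrite !mxE big_ord1 !mxE !l0 r0.
    by field.
  apply/matrixP => i j; rewrite !mxE big_ord1 !mxE !l0 !r0.
  by field.
have dL : \det L = 1 by rewrite det_lblock !det1 mulr1.
have dT : \det T = M 0 0 * \det (schur M) by rewrite det_ublock det_mx11 !mxE !l0.
by rewrite -dT -[RHS]mul1r -dL -det_mulmx -NE.
Qed.

Lemma symposdef00 n (M : 'M[R]_n.+1) : symposdef M -> 0 < M 0 0.
Proof.
move=> [_ Mpos]; have := Mpos (delta_mx 0 0).
have -> : delta_mx 0 0 != 0 :> 'cV[R]_n.+1.
  by apply/eqP => /matrixP/(_ 0 0); rewrite !mxE => /eqP; rewrite oner_eq0.
by rewrite trmx_delta -rowE -colE !mxE => /(_ isT).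
Qed.

(** The Schur complement at y is the value of M at the vector that extends y by
    the minimizing first coordinate. *)
Lemma symposdef_schur n (M : 'M[R]_n.+1) : symposdef M -> symposdef (schur M).
Proof.
move=> PM; have M0 := symposdef00 PM; have [Msym Mpos] := PM.
have sym i j : M i j = M j i by rewrite -[in LHS]Msym mxE.
split.
  apply/matrixP => i j; rewrite !mxE; congr (_ - _ / _); first exact: sym.
  by rewrite mulrC; congr (_ * _); exact: sym.
move=> y y0.
pose s := \sum_j M 0 (lift 0 j) * y j 0.
pose v : 'cV[R]_n.+1 := \col_i (if unlift 0 i is Some j then y j 0 else - (s / M 0 0)).
have vl j : v (lift 0 j) 0 = y j 0 by rewrite mxE liftK.
have v0 : v 0 0 = - (s / M 0 0) by rewrite mxE unlift_none.
have vn0 : v != 0.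
  apply: contraNneq y0 => v_eq0; apply/eqP/matrixP => i j.
  by rewrite ord1 -vl v_eq0 !mxE.
have := Mpos _ vn0; rewrite -/(qform M v) qform_schur ?gt_eqF// v0.
under eq_bigr do rewrite vl.
rewrite -/s addNr expr0n/= mulr0 add0r /qform.
suff -> : \col_j v (lift 0 j) 0 = y by [].
by apply/matrixP => i j; rewrite !mxE liftK ord1.
Qed.

Lemma det_symposdef_gt0 n (M : 'M[R]_n) : symposdef M -> 0 < \det M.
Proof.
elim: n M => [|n IH] M PM; first by rewrite det_mx00.
have M0 := symposdef00 PM.
by rewrite det_schur ?gt_eqF// mulr_gt0// IH//; exact: symposdef_schur.
Qed.

Lemma symposdef_mxsub n m (f : 'I_m -> 'I_n) (M : 'M[R]_n) : injective f ->
  symposdef M -> symposdef (mxsub f f M).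
Proof.
move=> finj [Msym Mpos]; split.
  by apply/matrixP => i j; rewrite !mxE -[in RHS]Msym mxE.
pose Q : 'M[R]_(m, n) := rowsub f 1%:M.
have QE : mxsub f f M = Q *m M *m Q^T.
  apply/matrixP => i j; rewrite /Q mul_rowsub_mx mul1mx.
  rewrite !mxE (bigD1 (f j))//= !mxE eqxx mulr1 big1 ?addr0// => k kj.
  by rewrite !mxE eq_sym (negbTE kj) mulr0.
have QQ : Q *m Q^T = 1%:M.
  apply/matrixP => i j; rewrite /Q mul_rowsub_mx mul1mx !mxE.
  by rewrite eq_sym (inj_eq finj) eq_sym.
move=> x x0; have /Mpos : Q^T *m x != 0.
  apply: contraNneq x0 => Qx0.
  by rewrite -[x]mul1mx -QQ -mulmxA Qx0 mulmx0.
by rewrite QE trmx_mul trmxK !mulmxA.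
Qed.

Lemma symposdef_leadmx n (M : 'M[R]_n.+1) : symposdef M -> symposdef (leadmx M).
Proof.
have -> : leadmx M = mxsub (widen_ord (leqnSn n)) (widen_ord (leqnSn n)) M.
  by apply/matrixP => i j; rewrite !mxE.
by apply: symposdef_mxsub => i j /(congr1 val)/= ?; exact: val_inj.
Qed.

(** Both the rows and the columns are permuted, so the two signs cancel. *)
Lemma det_mxsub_perm n p (s t : n.-tuple 'I_p) (U : 'M[R]_p) : perm_eq s t ->
  \det (mxsub (tnth s) (tnth s) U) = \det (mxsub (tnth t) (tnth t) U).
Proof.
move=> /tuple_permP[q sE].
have {}sE i : tnth s i = tnth t (q i) by rewrite (tnth_nth (tnth t (q i))) sE -tnth_nth tnth_mktuple.
have -> : mxsub (tnth s) (tnth s) U = row_perm q (col_perm q (mxsub (tnth t) (tnth t) U)).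
  by apply/matrixP => i j; rewrite !mxE !sE.
rewrite row_permE col_permE !det_mulmx !det_perm mulrCA.
by rewrite odd_permV -signr_addb addbb mulr1.
Qed.

End LinAlg.

(** * Lebesgue measure on R^n, one coordinate at a time *)

Section Leb.
Context {R : realType}.
Local Notation RT := (measurableTypeR R).

(** The integrand is a function of sequences and not of n-tuples, so that the
    dimension n can be rewritten without casts. *)
Definition lebint n (g : seq R -> R) : \bar R :=
  (\int[leb (n := n)]_x (g (x : n.-tuple RT))%:E)%E.

Definition tuple_measurable n (g : seq R -> R) :=
  measurable_fun setT (fun x : n.-tuple RT => g x).

Lemma lebint0 (g : seq R -> R) : lebint 0 g = (g [::])%:E.
Proof.
rewrite /lebint /= integral_dirac//; first by rewrite diracT mul1e.
apply/measurable_EFinP => _ Y mY; rewrite setTI.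
have [gY|gY] := pselect (Y (g [::])).
  rewrite (_ : _ @^-1` _ = setT)//; apply/seteqP; split=> // x _ /=.
  by rewrite (tuple0 x).
rewrite (_ : _ @^-1` _ = set0)//; apply/seteqP; split=> // x /=.
by rewrite (tuple0 x).
Qed.

Lemma tuple_measurable_cons n g : tuple_measurable n.+1 g ->
  measurable_fun setT (fun z : RT * n.-tuple RT => (g (z.1 :: z.2))%:E).
Proof.
move=> mg; apply/measurable_EFinP.
exact: measurableT_comp mg (@measurable_cons_pair R n).
Qed.

Lemma tuple_measurable_behead n g x : tuple_measurable n.+1 g -> tuple_measurable n (fun s => g (x :: s)).
Proof.
move=> mg.
have mx : measurable_fun setT (fun t : n.-tuple RT => [the n.+1.-tuple RT of x :: t]).
  by apply: measurable_cons; [exact: measurable_cst|exact: measurable_id].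
exact: measurableT_comp mg mx.
Qed.

Lemma lebint_prod n g : tuple_measurable n.+1 g -> (forall s, 0 <= g s) ->
  lebint n.+1 g =
  (\int[@lebesgue_measure R \x leb (n := n)]_z (g (z.1 :: z.2))%:E)%E.
Proof.
move=> mg g0; rewrite /lebint.
rewrite -[leb (n := n.+1)]/(pushforward (@lebesgue_measure R \x leb (n := n))%E (@cons_pair R n)).
rewrite ge0_integral_pushforward//.
- exact: measurable_cons_pair.
- exact/measurable_EFinP.
- by move=> x _; rewrite lee_fin.
Qed.

Lemma lebint_cons n g : tuple_measurable n.+1 g -> (forall s, 0 <= g s) ->
  lebint n.+1 g = (\int[@lebesgue_measure R]_x lebint n (fun s => g (x :: s)))%E.
Proof.
move=> mg g0; rewrite lebint_prod// fubini_tonelli1//.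
- exact: tuple_measurable_cons.
- by move=> z; rewrite lee_fin.
Qed.

(** The other order of integration, used to eliminate the first variable while
    the remaining ones are kept as parameters. *)
Lemma lebint_cons_swap n g : tuple_measurable n.+1 g -> (forall s, 0 <= g s) ->
  lebint n.+1 g =
  (\int[leb (n := n)]_t \int[@lebesgue_measure R]_x (g (x :: (t : n.-tuple RT)))%:E)%E.
Proof.
move=> mg g0; rewrite lebint_prod// fubini_tonelli2//.
- exact: tuple_measurable_cons.
- by move=> z; rewrite lee_fin.
Qed.

Lemma measurable_lebint_cons n g : tuple_measurable n.+1 g -> (forall s, 0 <= g s) ->
  measurable_fun setT (fun x : RT => lebint n (fun s => g (x :: s))).
Proof.
move=> mg g0.
apply: (@measurable_fun_fubini_tonelli_F _ _ _ _ _ (leb (n := n))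
  (fun z : RT * n.-tuple RT => (g (z.1 :: z.2))%:E)).
- exact: tuple_measurable_cons.
- by move=> z; rewrite lee_fin.
Qed.

Lemma lebint_ge0 n g : (forall s, 0 <= g s) -> (0 <= lebint n g)%E.
Proof. by move=> g0; apply: integral_ge0 => x _; rewrite lee_fin. Qed.

Lemma eq_lebint n (g1 g2 : seq R -> R) : (forall x : n.-tuple R, g1 x = g2 x) -> lebint n g1 = lebint n g2.
Proof. by move=> g12; apply: eq_integral => x _; rewrite g12. Qed.

Lemma lebintZ n k g : tuple_measurable n g -> (forall s, 0 <= g s) -> 0 <= k ->
  lebint n (fun s => k * g s) = (k%:E * lebint n g)%E.
Proof.
move=> mg g0 k0; rewrite /lebint -ge0_integralZl_EFin//.
- by move=> x _; rewrite lee_fin.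
- exact/measurable_EFinP.
Qed.

(** * Gaussian integrals *)

Lemma integral_gauss (a m : R) : 0 < a ->
  (\int[@lebesgue_measure R]_x (expR (- (a * (x + m) ^+ 2)))%:E =
   (Num.sqrt (pi / a))%:E)%E.
Proof.
move=> a0; pose s := Num.sqrt ((2 * a)^-1).
have s2 : s ^+ 2 = (2 * a)^-1 by rewrite sqr_sqrtr// invr_ge0 mulr_ge0// ltW.
have s0 : s != 0 by rewrite gt_eqF// sqrtr_gt0 invr_gt0 mulr_gt0.
have peakE : normal_peak s = (Num.sqrt (pi / a))^-1.
  by rewrite /normal_peak s2; congr ((Num.sqrt _)^-1); field; rewrite gt_eqF.
have pa0 : 0 < Num.sqrt (pi / a) by rewrite sqrtr_gt0 divr_gt0 ?pi_gt0.
have -> : (fun x => (expR (- (a * (x + m) ^+ 2)))%:E) =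
          (fun x => (Num.sqrt (pi / a))%:E * (normal_pdf (- m) s x)%:E)%E.
  apply/funext => x; rewrite -EFinM normal_pdfE//= peakE.
  rewrite mulVKf ?gt_eqF//.
  by rewrite /normal_fun s2; congr (expR _)%:E; field; rewrite gt_eqF.
rewrite ge0_integralZl_EFin ?ltW//.
- by rewrite integral_normal_pdf mule1.
- by move=> x _; rewrite lee_fin normal_pdf_ge0.
- by apply/measurable_EFinP; exact: measurable_normal_pdf.
Qed.

(** The column (s, 1): for a sequence s of length n the default value 1 fills
    the last coordinate. *)
Definition affine_col n (s : seq R) : 'cV[R]_n.+1 := \col_i nth 1 s i.

Lemma measurable_qform_affine_col d (X : measurableType d) n (y : X -> n.-tuple RT)
    (M : 'M[R]_n.+1) : measurable_fun setT y ->
  measurable_fun setT (fun x => qform M (affine_col n (y x))).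
Proof.
move=> my.
have mnth (i : 'I_n.+1) : measurable_fun setT (fun x => nth 1 (y x) i).
  have [ni|ni] := ltnP i n; last first.
    rewrite (_ : (fun _ => _) = cst 1); first exact: measurable_cst.
    by apply/funext => x; rewrite nth_default// size_tuple.
  rewrite (_ : (fun _ => _) = (fun x => tnth (y x) (Ordinal ni))).
    exact: (measurable_fun_tnthP y).1.
  by apply/funext => x; rewrite (tnth_nth 1).
rewrite (_ : (fun _ => _) =
  (fun x => \sum_(i < n.+1) \sum_(j < n.+1) nth 1 (y x) i * M i j * nth 1 (y x) j)).
  apply: measurable_sum => i; apply: measurable_sum => j.
  by apply: measurable_funM => //; apply: measurable_funM => //; exact: measurable_cst.
apply/funext => x; rewrite qformE; apply: eq_bigr => i _; apply: eq_bigr => j _.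
by rewrite !mxE.
Qed.

Definition gauss_qform n t (M : 'M[R]_n.+1) (s : seq R) := expR (- (t * qform M (affine_col n s))).

Lemma measurable_gauss_qform d (X : measurableType d) n (y : X -> n.-tuple RT) (t : X -> R)
    (M : 'M[R]_n.+1) : measurable_fun setT y -> measurable_fun setT t ->
  measurable_fun setT (fun x => gauss_qform (t x) M (y x)).
Proof.
move=> my mt; apply: measurableT_comp => //; apply: measurableT_comp => //.
by apply: measurable_funM => //; exact: measurable_qform_affine_col.
Qed.

(** Induction on n: integrating the first variable leaves the Gaussian of the
    Schur complement and the factor sqrt (pi / (t M_00)), and M_00 is the pivot
    of both determinants. *)
Lemma lebint_gauss n (M : 'M[R]_n.+1) (t : R) : symposdef M -> 0 < t ->
  lebint n (gauss_qform t M) =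
  (Num.sqrt (pi / t) ^+ n / Num.sqrt (\det (leadmx M)) *
   expR (- (t * (\det M / \det (leadmx M)))))%:E.
Proof.
elim: n M => [|n IH] M PM t0.
  rewrite expr0 !det_mx00 sqrtr1 !divr1 mul1r det_mx11.
  by rewrite lebint0 /gauss_qform qformE !big_ord1 !mxE mul1r mulr1.
have M0 := symposdef00 PM; have M0n : M 0 0 != 0 by rewrite gt_eqF.
have g0 m u (N : 'M[R]_m.+1) s : 0 <= gauss_qform u N s by exact: expR_ge0.
have mg m u (N : 'M[R]_m.+1) : tuple_measurable m (gauss_qform u N).
  by apply: measurable_gauss_qform; [exact: measurable_id|exact: measurable_cst].
rewrite lebint_cons_swap//.
(* m is minus the first coordinate of the minimizer when the others are s *)
have inner (s : seq R) : (\int[@lebesgue_measure R]_x (gauss_qform t M (x :: s))%:E =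
    (Num.sqrt (pi / (t * M 0 0)) * gauss_qform t (schur M) s)%:E)%E.
  pose m := (\sum_j M 0 (lift 0 j) * nth 1 s j) / M 0 0.
  have E x : gauss_qform t M (x :: s) =
      gauss_qform t (schur M) s * expR (- (t * M 0 0 * (x + m) ^+ 2)).
    rewrite /gauss_qform -expRD qform_schur//; last by have [] := PM.
    congr expR; rewrite mxE/=.
    under eq_bigr do rewrite mxE/=.
    rewrite -/m.
    have -> : \col_j affine_col n.+1 (x :: s) (lift 0 j) 0 = affine_col n s.
      by apply/matrixP => i j; rewrite !mxE.
    by ring.
  under eq_integral do rewrite E EFinM.
  have mE : measurable_fun setT (fun x : RT => (expR (- (t * M 0 0 * (x + m) ^+ 2)))%:E).
    apply/measurable_EFinP; apply: measurableT_comp => //; apply: measurableT_comp => //.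
    by apply: measurable_funM => //; apply: measurable_funX; exact: measurable_funD.
  rewrite ge0_integralZl_EFin ?g0//.

  by rewrite integral_gauss ?mulr_gt0// -EFinM mulrC.
under eq_integral do rewrite inner.
rewrite -/(lebint n (fun s => _ * gauss_qform t (schur M) s)).
rewrite lebintZ ?sqrtr_ge0// IH//; last exact: symposdef_schur.
rewrite -EFinM; congr EFin.
have PL := symposdef_leadmx PM.
have PS := symposdef_leadmx (symposdef_schur PM).
have detS := det_symposdef_gt0 PS.
have L0 : leadmx M 0 0 = M 0 0 by rewrite mxE; congr (M _ _); exact: val_inj.
have detL : \det (leadmx M) = M 0 0 * \det (leadmx (schur M)).
  by rewrite det_schur L0// leadmx_schur.
rewrite [\det M]det_schur// detL -mulf_div divff// mul1r mulrA; congr (_ * _).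
have -> : pi / (t * M 0 0) = pi / t / M 0 0 by field; rewrite !gt_eqF.
rewrite [Num.sqrt (pi / t / M 0 0)]sqrtrM ?divr_ge0 ?pi_ge0 ?ltW// sqrtrV ?ltW//.
set r := Num.sqrt (pi / t).
rewrite [Num.sqrt (M 0 0 * _)]sqrtrM ?(ltW M0)// exprS; field.
by rewrite !gt_eqF// sqrtr_gt0.
Qed.

End Leb.

(** * Products over blocks of coordinates *)

Section Blocks.
Context {R : realType}.
Local Notation RT := (measurableTypeR R).

Lemma tuple_measurable_nth n i (g : R -> R) : (i < n)%N -> measurable_fun setT g ->
  tuple_measurable n (fun s => g (nth 0 s i)).
Proof.
move=> ni mg.
rewrite /tuple_measurable (_ : (fun _ => _) = (fun x : n.-tuple RT => g (tnth x (Ordinal ni)))).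
  exact: measurableT_comp mg (@measurable_tnth _ _ _ _).
by apply/funext => x; rewrite (tnth_nth 0).
Qed.

Lemma lebint_prod_coord n (g : 'I_n -> R -> R) :
  (forall i, measurable_fun setT (g i)) -> (forall i x, 0 <= g i x) ->
  lebint n (fun s => \prod_i g i (nth 0 s i)) =
  (\prod_i \int[@lebesgue_measure R]_x (g i x)%:E)%E.
Proof.
elim: n g => [|n IH] g mg g0; first by rewrite lebint0 !big_ord0.
have mP m (h : 'I_m -> R -> R) : (forall i, measurable_fun setT (h i)) ->
    tuple_measurable m (fun s => \prod_i h i (nth 0 s i)).
  by move=> mh; apply: measurable_prod => i _; exact: tuple_measurable_nth.
have P0 m (h : 'I_m -> R -> R) s : (forall i x, 0 <= h i x) ->
    0 <= \prod_i h i (nth 0 s i).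
  by move=> h0; apply: prodr_ge0.
rewrite lebint_cons//; [|exact: mP|by move=> s; exact: P0].
under eq_integral => x _.
  have -> : lebint n (fun s => \prod_(i < n.+1) g i (nth 0 (x :: s) i)) =
      ((g ord0 x)%:E * \prod_(i < n) \int[@lebesgue_measure R]_y (g (lift ord0 i) y)%:E)%E.
    rewrite -IH//.
    have mP' := mP n (fun i => g (lift ord0 i)) (fun i => mg (lift ord0 i)).
    have P0' s := P0 n (fun i => g (lift ord0 i)) s (fun i => g0 (lift ord0 i)).
    rewrite -(lebintZ mP' P0' (g0 ord0 x)).
    by apply: eq_lebint => s; rewrite big_ord_recl.
  over.
rewrite ge0_integralZr//.
- by rewrite big_ord_recl.
- by apply/measurable_EFinP; exact: mg.
- by move=> x _; rewrite lee_fin.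
- by apply: prode_ge0 => i _; apply: integral_ge0 => x _; rewrite lee_fin.
Qed.

(** The coordinates of s that carry the label i, where bs is the list of labels
    of all the coordinates. *)
Definition block (I : eqType) (bs : seq I) (i : I) (s : seq R) : seq R :=
  mask [seq b == i | b <- bs] s.

Lemma size_block (I : eqType) (bs : seq I) i s : size s = size bs ->
  size (block bs i s) = count_mem i bs.
Proof. by move=> ss; rewrite size_mask ?size_map// count_map. Qed.

Lemma size_block_tuple (I : eqType) (bs : seq I) i (x : (size bs).-tuple RT) :
  size (block bs i x) == count_mem i bs.
Proof. by rewrite size_block// size_tuple. Qed.

Definition blockT (I : eqType) (bs : seq I) i (x : (size bs).-tuple RT) :
  (count_mem i bs).-tuple RT := Tuple (size_block_tuple i x).

(** Each coordinate of a block is a fixed coordinate of the whole tuple, found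
    by masking the list of positions. *)
Lemma measurable_blockT (I : eqType) (bs : seq I) i :
  measurable_fun setT (@blockT I bs i).
Proof.
apply/measurable_fun_tnthP => k.
pose m := [seq b == i | b <- bs].
pose j := nth 0%N (mask m (iota 0 (size bs))) k.
have sm : size (mask m (iota 0 (size bs))) = count_mem i bs.
  by rewrite size_mask ?size_iota ?size_map// count_map.
have jn : (j < size bs)%N.
  have : j \in iota 0 (size bs) by apply: mem_mask (mem_nth 0%N _); rewrite sm.
  by rewrite mem_iota.
rewrite (_ : _ \o _ = (fun x => tnth x (Ordinal jn))); first exact: measurable_tnth.
apply/funext => x; rewrite /= !(tnth_nth 0)/= /block -/m.
have {1}-> : tval x = [seq nth 0 x l | l <- iota 0 (size bs)].
  by rewrite -[in iota _ _](size_tuple x) -/(mkseq _ _) mkseq_nth.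
by rewrite -map_mask (nth_map 0%N) ?sm.
Qed.

(** Tonelli for a product of functions of disjoint groups of coordinates, in
    whatever order the groups are interleaved: the first coordinate belongs to
    one block b, and for a fixed value x of it the induction hypothesis applies
    with f b (x :: _) in place of f b. *)
Lemma lebint_prod_block (I : finType) (bs : seq I) (f : I -> seq R -> R) :
  (forall i, tuple_measurable (count_mem i bs) (f i)) -> (forall i s, 0 <= f i s) ->
  lebint (size bs) (fun s => \prod_i f i (block bs i s)) =
  (\prod_i lebint (count_mem i bs) (f i))%E.
Proof.
elim: bs f => [|b bs IH] f mf f0.
  rewrite /= lebint0 -prodEFin; apply: eq_bigr => i _.
  by rewrite lebint0.
have P0 (h : I -> seq R -> R) cs s : (forall i t, 0 <= h i t) ->
    0 <= \prod_i h i (block cs i s) by move=> h0; apply: prodr_ge0.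
have cb : count_mem b (b :: bs) = (count_mem b bs).+1 by rewrite /= eqxx.
have cNb i : i != b -> count_mem i (b :: bs) = count_mem i bs.
  by move=> ib; rewrite /= eq_sym (negbTE ib).
have mb : tuple_measurable (count_mem b bs).+1 (f b) by rewrite -cb.
rewrite lebint_cons//; first last.
- by move=> s; exact: P0.
- apply: measurable_prod => i _.
  exact: (measurableT_comp (mf i) (@measurable_blockT I (b :: bs) i)).
under eq_integral => x _.
  pose f' i s := if i == b then f b (x :: s) else f i s.
  have -> : lebint (size bs) (fun s => \prod_i f i (block (b :: bs) i (x :: s))) =
      (lebint (count_mem b bs) (fun s => f b (x :: s)) *
       \prod_(i | i != b) lebint (count_mem i (b :: bs)) (f i))%E.
    transitivity (lebint (size bs) (fun s => \prod_i f' i (block bs i s))).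
      apply: eq_lebint => s; apply: eq_bigr => i _; rewrite /f' /block/= eq_sym.
      by case: eqP => // ->.
    rewrite IH.
    - rewrite (bigD1 b)//=; congr (_ * _)%E.
        by apply: eq_lebint => s; rewrite /f' eqxx.
      apply: eq_bigr => i ib; rewrite -[((b == i) + _)%N]/(count_mem i (b :: bs)) cNb//.
      by apply: eq_lebint => s; rewrite /f' (negbTE ib).
    - move=> i; rewrite /f'; have [->|ib] := eqVneq i b; first exact: tuple_measurable_behead.
      by rewrite -cNb.
    - by move=> i s; rewrite /f'; case: ifP.
  over.
rewrite ge0_integralZr//.
- by rewrite [RHS](bigD1 b)//= eqxx lebint_cons.
- exact: measurable_lebint_cons.
- by move=> x _; apply: lebint_ge0.
- by apply: prode_ge0 => i _; apply: lebint_ge0.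
Qed.

End Blocks.

(** * The columns of L *)

Section Columns.
Context {R : realType}.
Variables (p : nat) (E : {set 'I_p * 'I_p}).
Local Notation RT := (measurableTypeR R).
Implicit Types (i j : 'I_p) (U : 'M[R]_p).

(** The free coordinates of L in the order in which they parametrize it, each
    labelled by its column. *)
Definition heads : seq 'I_p := [seq e.2 | e <- enum (coords E)].

Definition rows i : seq 'I_p := [seq e.1 | e <- enum (coords E) & e.2 == i].

(** This is pa_i, in the form in which the dimension of a block arises. *)
Definition npa i : nat := count_mem i heads.

(** U restricted to fa(i), with the parents first and i last: the default value
    i of [nth] supplies the last index. *)
Definition column_form U i : 'M[R]_((npa i).+1) :=
  mxsub (fun a : 'I_((npa i).+1) => nth i (rows i) a) (fun a : 'I_((npa i).+1) => nth i (rows i) a) U.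

Lemma size_heads : size heads = #|coords E|.
Proof. by rewrite size_map -cardE. Qed.

Lemma size_rows i : size (rows i) = npa i.
Proof. by rewrite /npa /heads count_map size_map size_filter. Qed.

Lemma mem_rows i j : (j \in rows i) = ((j, i) \in coords E).
Proof.
apply/mapP/idP => [[[a b]]|jiE]; last by exists (j, i) => //; rewrite mem_filter mem_enum jiE/= eqxx.
by rewrite mem_filter mem_enum/= => /andP[/eqP -> ?] ->.
Qed.

Lemma uniq_rows i : uniq (rows i).
Proof.
rewrite map_inj_in_uniq; first by apply: filter_uniq; exact: enum_uniq.
move=> -[a b] [a' b'].
by rewrite !mem_filter/= => /andP[/eqP -> _] /andP[/eqP -> _] ->.
Qed.

Lemma rows_irrefl i : i \notin rows i.
Proof. by rewrite mem_rows inE/= ltnn andbF. Qed.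

Lemma Lmx_rows i j (l : #|coords E|.-tuple RT) : j != i ->
  Lmx l j i = if j \in rows i then nth 0 l (index (j, i) (enum (coords E))) else 0.
Proof. by move=> ji; rewrite mxE (negbTE ji) mem_rows. Qed.

Lemma block_Lmx_col i (l : #|coords E|.-tuple RT) : block heads i l = [seq Lmx l j i | j <- rows i].
Proof.
pose g e : R := nth 0 l (index e (enum (coords E))).
have lE : tval l = [seq g e | e <- enum (coords E)].
  apply: (@eq_from_nth _ 0) => [|k]; first by rewrite size_tuple size_map -cardE.
  rewrite size_tuple => kN; have kE : (k < size (enum (coords E)))%N by rewrite -cardE.
  have e0 : 'I_p * 'I_p.
    by case: (enum (coords E)) kE => [//|e _ _].
  by rewrite (nth_map e0)// /g index_uniq ?enum_uniq.
rewrite {1}lE /block /heads /rows -!map_comp -map_mask -filter_mask.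
apply/eq_in_map => -[a b]; rewrite mem_filter mem_enum/= => /andP[/eqP -> aiE].
have ai : a != i by apply: contraTneq aiE => ->; rewrite -mem_rows (negbTE (rows_irrefl i)).
by rewrite Lmx_rows// mem_rows aiE.
Qed.

(** Column i of L consists of the i-th block of coordinates on the parents of
    i, in the order of [rows i], and of 1 at i. *)
Lemma sum_Lmx_col i (l : #|coords E|.-tuple RT) (F : 'I_p -> R) :
  \sum_j Lmx l j i * F j =
  \sum_(a < (npa i).+1) nth 1 (block heads i l) a * F (nth i (rows i) a).
Proof.
have sB : size (block heads i l) = npa i by rewrite size_block// size_tuple size_heads.
rewrite big_ord_recr/= !nth_default ?sB ?size_rows// mul1r.
rewrite (bigD1 i)//= addrC mxE eqxx mul1r; congr (_ + _).
transitivity (\sum_(j in rows i) Lmx l j i * F j).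
  rewrite big_mkcond [RHS]big_mkcond; apply: eq_bigr => j _.
  have [->|ji] := eqVneq j i; first by rewrite (negbTE (rows_irrefl i)).
  by rewrite Lmx_rows//; case: ifP => // _; rewrite mul0r.
rewrite -big_uniq ?uniq_rows// (big_nth i) size_rows big_mkord.
apply: eq_bigr => a _; rewrite block_Lmx_col (nth_map i) ?size_rows//.
Qed.

Lemma qform_Lmx_col U i (l : #|coords E|.-tuple RT) :
  qform U (col i (Lmx l)) = qform (column_form U i) (affine_col (npa i) (block heads i l)).
Proof.
rewrite !qformE.
have cE j : col i (Lmx l) j 0 = Lmx l j i by rewrite [LHS]mxE.
under eq_bigr do under eq_bigr do rewrite !cE -mulrA.
under eq_bigr do rewrite -mulr_sumr.
rewrite sum_Lmx_col; apply: eq_bigr => a _.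
under [in LHS]eq_bigr do rewrite mulrC.
rewrite (sum_Lmx_col i l (fun j => U (nth i (rows i) a) j)) mulr_sumr.
apply: eq_bigr => b _; rewrite !mxE; ring.
Qed.

(** The determinant of a principal submatrix does not depend on the order in
    which its index set is listed. *)
Lemma det_principal U (A : {set 'I_p}) (s : seq 'I_p) n x0 :
  uniq s -> s =i A -> size s = n ->
  \det (mxsub (fun a : 'I_n => nth x0 s a) (fun a : 'I_n => nth x0 s a) U) =
  \det (principal U A).
Proof.
move=> us sA sn.
have perm_s : perm_eq s (enum A).
  by apply: uniq_perm; rewrite ?enum_uniq// => j; rewrite mem_enum sA.
have nA : n = #|A| by rewrite -sn (perm_size perm_s) -cardE.
subst n; have ss : size s == #|A| by rewrite nA.
rewrite nA; transitivity (\det (mxsub (tnth (Tuple ss)) (tnth (Tuple ss)) U)).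
  by congr (\det _); apply/matrixP => i j; rewrite !mxE !(tnth_nth x0).
rewrite (@det_mxsub_perm _ _ _ _ (enum_tuple A))//.
by congr (\det _); apply/matrixP => i j; rewrite !mxE !(enum_val_nth x0) !(tnth_nth x0).
Qed.

Hypothesis pE : parent_ordering E.

Lemma rows_pa i : rows i =i pa E i.
Proof.
move=> j; rewrite mem_rows !inE/= /edge; apply/andP/andP => [[-> ij]|[ji jiE]].
  by split=> //; rewrite -val_eqE neq_ltn ij orbT.
by split=> //; apply: pE; rewrite /edge ji.
Qed.

Lemma npaE i : npa i = #|pa E i|.
Proof.
rewrite -size_rows -(card_uniqP (uniq_rows i)); apply: eq_card => j.
by rewrite rows_pa.
Qed.

Lemma nth_rows i a : nth i (rows i) a = nth i (rcons (rows i) i) a.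
Proof.
rewrite nth_rcons; case: ltngtP => // [sa|->]; rewrite nth_default//; exact: ltnW.
Qed.

Lemma det_column_form U i : \det (column_form U i) = \det (principal U (fa E i)).
Proof.
rewrite -(@det_principal _ _ (rcons (rows i) i) (npa i).+1 i).
- by congr (\det _); apply/matrixP => a b; rewrite !mxE !nth_rows.
- by rewrite rcons_uniq rows_irrefl uniq_rows.
- by move=> j; rewrite mem_rcons in_cons rows_pa /fa in_setU1.
- by rewrite size_rcons size_rows.
Qed.

Lemma det_leadmx_column_form U i : \det (leadmx (column_form U i)) = \det (principal U (pa E i)).
Proof.
rewrite -(@det_principal _ _ (rows i) (npa i) i) ?uniq_rows ?size_rows//.
  by congr (\det _); apply/matrixP => a b; rewrite !mxE.
exact: rows_pa.
Qed.

Lemma symposdef_column_form U i : symposdef U -> symposdef (column_form U i).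
Proof.
apply: symposdef_mxsub => a b; rewrite !nth_rows => /eqP.
rewrite nth_uniq ?size_rcons ?size_rows//; last by rewrite rcons_uniq rows_irrefl uniq_rows.
by move=> /eqP; exact: val_inj.
Qed.

Lemma mxtrace_LDLU U (l : #|coords E|.-tuple RT) (d : p.-tuple RT) :
  (forall i, 0 < tnth d i) ->
  \tr (Lmx l *m invmx (Dmx d) *m (Lmx l)^T *m U) =
  \sum_i (tnth d i)^-1 * qform U (col i (Lmx l)).
Proof.
move=> d0.
have invD : invmx (Dmx d) = diag_mx (\row_i (tnth d i)^-1).
  have DD : Dmx d *m diag_mx (\row_i (tnth d i)^-1) = 1%:M.
    rewrite /Dmx mulmx_diag -diag_const_mx; congr diag_mx; apply/rowP => i.
    by rewrite !mxE divff// gt_eqF.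
  have [uD _] := mulmx1_unit DD.
  by rewrite -[RHS]mul1mx -(mulVmx uD) -mulmxA DD mulmx1.
rewrite invD -!mulmxA mxtrace_mulC -!mulmxA /mxtrace; apply: eq_bigr => i _.
rewrite mul_diag_mx !mxE; congr (_ * _).
rewrite qformE; apply: eq_bigr => j _; rewrite !mxE mulr_sumr.
apply: eq_bigr => k _; rewrite !mxE; ring.
Qed.

End Columns.

(** * The integral over Theta *)

Section Assembly.
Context {R : realType}.
Variables (p : nat) (E : {set 'I_p * 'I_p}) (U : 'M[R]_p) (alpha : 'rV[R]_p).
Local Notation RT := (measurableTypeR R).
Local Notation mu := (@lebesgue_measure R).
Hypotheses (pE : parent_ordering E) (PU : symposdef U).
Implicit Types i : 'I_p.

Let M i := column_form E U i.
(** The minimum of the form M i at vectors with last coordinate 1. *)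
Let residual i := \det (M i) / \det (leadmx (M i)).
(** Shape and constant factor of the inverse-gamma integral in D_ii. *)
Let shape i := alpha 0 i / 2 - #|pa E i|%:R / 2 - 1.
Let scale i := Num.sqrt (2 * pi) ^+ npa E i / Num.sqrt (\det (leadmx (M i))).

Lemma det_leadmx_gt0 i : 0 < \det (leadmx (M i)).
Proof. by apply: det_symposdef_gt0; apply: symposdef_leadmx; exact: symposdef_column_form. Qed.

Lemma residual_gt0 i : 0 < residual i.
Proof. by rewrite divr_gt0 ?det_leadmx_gt0// det_symposdef_gt0//; exact: symposdef_column_form. Qed.

(** The part of the integrand that depends on D_ii = d and on column i of L,
    extended by 0 to d <= 0 so that Tonelli can be used on the whole space. *)
Definition factor i (d : R) (s : seq R) : R :=
  \1_(`]0, +oo[%classic : set R) d *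
  (d `^ (- (2^-1 * alpha 0 i)) * gauss_qform ((2 * d)^-1) (M i) s).

Lemma factor_ge0 i d s : 0 <= factor i d s.
Proof. by rewrite mulr_ge0 ?mulr_ge0 ?powR_ge0 ?expR_ge0. Qed.

Lemma measurable_factor dX (X : measurableType dX) i (d : X -> RT)
    (y : X -> (npa E i).-tuple RT) :
  measurable_fun setT d -> measurable_fun setT y ->
  measurable_fun setT (fun x => factor i (d x) (y x)).
Proof.
move=> md my; apply: measurable_funM.
  have mi : measurable_fun setT (\1_(`]0, +oo[%classic : set R) : RT -> R).
    exact: measurable_indic.
  exact: measurableT_comp mi md.
apply: measurable_funM.
  exact: measurableT_comp (@measurable_powR R (- (2^-1 * alpha 0 i))) md.
apply: measurable_gauss_qform => //; apply: (measurableT_comp measurable_invr).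
by apply: measurable_funM.
Qed.

Lemma indic_gt0 (d : R) : \1_(`]0, +oo[%classic : set R) d = (0 < d)%R%:R :> R.
Proof. by rewrite indicE mem_setE in_itv/= andbT. Qed.

Lemma integrand_factor (l : #|coords E|.-tuple RT) (d : p.-tuple RT) :
  (forall i, 0 < tnth d i) ->
  integrand U alpha (DLmx (l, d)) =
  \prod_i factor i (nth 0 d i) (block (heads E) i l).
Proof.
move=> d0; rewrite /integrand/= mxtrace_LDLU// mulr_sumr -sumrN expR_sum -big_split/=.
apply: eq_bigr => i _; rewrite /factor -tnth_nth indic_gt0 d0 mul1r mulrC.
rewrite !mxE eqxx mulr1n; congr (_ * expR (- _)).
by rewrite qform_Lmx_col mulrA -invfM.
Qed.

Lemma zint_factor : zint E U alpha =
  (\int[leb (n := #|coords E|) \x leb (n := p)]_x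
    (\prod_i factor i (nth 0 x.2 i) (block (heads E) i x.1))%:E)%E.
Proof.
rewrite /zint integral_mkcond; apply: eq_integral => -[l d] _.
rewrite patchE; case: ifPn => [|ld].
  rewrite inE/= => -[_ d0 _]; rewrite integrand_factor// => i.
  by have := d0 i; rewrite !mxE eqxx mulr1n.
have [i di] : exists i, ~~ (0 < tnth d i).
  apply/existsP; rewrite -negb_forall; apply: contra ld => /forallP d0.
  by rewrite inE/=; have [h _ _] := DLmx_bij R pE; apply: h.
by rewrite (bigD1 i)//= /factor indic_gt0 -tnth_nth (negbTE di) !mul0r.
Qed.

(** The Gaussian integral over column i with t = 1 / (2 d); its normalization
    (2 pi d)^(pa_i / 2) shifts the exponent of d. *)
Lemma lebint_factor i d : lebint (npa E i) (factor i d) =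
  (\1_(`]0, +oo[%classic : set R) d * (scale i * invgamma_fun (residual i / 2) (shape i) d))%:E.
Proof.
have [d0|d0] := boolP (0 < d); last first.
  rewrite indic_gt0 (negbTE d0) mul0r.
  by apply: integral0_eq => x _; rewrite /factor indic_gt0 (negbTE d0) mul0r.
have t0 : 0 < (2 * d)^-1 by rewrite invr_gt0 mulr_gt0.
rewrite [LHS](_ : _ = (d `^ (- (2^-1 * alpha 0 i)))%:E *
    lebint (npa E i) (gauss_qform (2 * d)^-1 (M i)))%E; last first.
  rewrite -lebintZ ?powR_ge0//.
  - by apply: eq_lebint => s; rewrite /factor indic_gt0 d0 mul1r.
  - by apply: measurable_gauss_qform; [exact: measurable_id|exact: measurable_cst].
  - by move=> s; exact: expR_ge0.
rewrite lebint_gauss//; last exact: symposdef_column_form.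
rewrite -EFinM indic_gt0 d0 mul1r -/(residual i) /scale /invgamma_fun; congr EFin.
set k := npa E i.
have -> : pi / (2 * d)^-1 = (2 * pi) * d by rewrite invrK; ring.
rewrite sqrtrM ?mulr_ge0 ?pi_ge0// exprMn.
have -> : (2 * d)^-1 * residual i = residual i / 2 / d by field; rewrite gt_eqF.
have -> : d `^ (- shape i - 1) = d `^ (- (2^-1 * alpha 0 i)) * Num.sqrt d ^+ k.
  rewrite -powR12_sqrt ?ltW// -powR_mulrn ?powR_ge0// -powRrM -powRD ?(gt_eqF d0) ?implybT//.
  by congr (_ `^ _); rewrite /shape -npaE// -/k; field.
by ring.
Qed.

(** For fixed D the integral over L splits into the columns, and the resulting
    function of D splits into the D_ii. *)
Lemma zint_prod : zint E U alpha =
  (\prod_i ((scale i)%:E * \int[mu]_(x in `]0%R, +oo[) (invgamma_fun (residual i / 2) (shape i) x)%:E))%E.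
Proof.
have K0 i : 0 <= scale i by rewrite divr_ge0 ?exprn_ge0 ?sqrtr_ge0.
pose G i d := \1_(`]0, +oo[%classic : set R) d * (scale i * invgamma_fun (residual i / 2) (shape i) d).
have G0 i d : 0 <= G i d by rewrite mulr_ge0// mulr_ge0// invgamma_fun_ge0.
have mG i : measurable_fun setT (G i).
  apply: measurable_funM; first exact: measurable_indic.
  by apply: measurable_funM => //; exact: measurable_invgamma_fun.
have P0 l (d : seq R) : 0 <= \prod_i factor i (nth 0 d i) (block (heads E) i l).
  by apply: prodr_ge0 => i _; exact: factor_ge0.
rewrite zint_factor fubini_tonelli2; last 2 first.
- apply/measurable_EFinP; apply: measurable_prod => i _.
  have md : measurable_fun setT (fun x : #|coords E|.-tuple RT * p.-tuple RT => nth 0 x.2 i).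
    rewrite (_ : (fun _ => _) = (fun x => tnth x.2 i)).
      exact: (measurableT_comp (@measurable_tnth _ _ _ i) measurable_snd).
    by apply/funext => x; rewrite (tnth_nth 0).
  have [y [my yE]] : exists y : #|coords E|.-tuple RT -> (npa E i).-tuple RT,
      measurable_fun setT y /\ forall l, y l = block (heads E) i l :> seq R.
    rewrite -size_heads; exists (@blockT R _ (heads E) i); split=> //.
    exact: measurable_blockT.
  under eq_fun do rewrite -yE.
  apply: (measurable_factor md); exact: measurableT_comp my measurable_fst.
- by move=> x; rewrite lee_fin.
rewrite /fubini_G.
transitivity (lebint p (fun d => \prod_i G i (nth 0 d i))).
  apply: eq_integral => d _ /=.
  rewrite -[LHS]/(lebint #|coords E| (fun l => \prod_i factor i (nth 0 d i) (block (heads E) i l))).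
  rewrite -size_heads (@lebint_prod_block _ _ (heads E) (fun i => factor i (nth 0 d i))).
  - by rewrite -prodEFin; apply: eq_bigr => i _; rewrite lebint_factor.
  - by move=> i; apply: measurable_factor; [exact: measurable_cst|exact: measurable_id].
  - by move=> i s; exact: factor_ge0.
rewrite lebint_prod_coord//; apply: eq_bigr => i _.
rewrite -ge0_integralZl_EFin//; last 2 first.
- by move=> x _; rewrite lee_fin invgamma_fun_ge0.
- by apply/measurable_EFinP; exact: measurable_invgamma_fun.
rewrite [RHS]integral_mkcond; apply: eq_integral => x _.
by rewrite epatch_indic /= -!EFinM /G mulrC.
Qed.

Lemma scale_gt0 i : 0 < scale i.
Proof. by rewrite divr_gt0 ?exprn_gt0 ?sqrtr_gt0 ?det_leadmx_gt0 ?mulr_gt0 ?pi_gt0. Qed.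

Lemma shape_gt0 i : (0 < shape i) = (#|pa E i|%:R + 2 < alpha 0 i).
Proof. by rewrite /shape; apply/idP/idP; lra. Qed.

Lemma zfactorE i : 0 < shape i ->
  scale i * ((residual i / 2) `^ (- shape i) * Gamma (shape i)) =
  Gamma (shape i) * 2 `^ (alpha 0 i / 2 - 1) * Num.sqrt pi ^+ #|pa E i| *
     \det (principal U (pa E i)) `^ (alpha 0 i / 2 - #|pa E i|%:R / 2 - 3 / 2) /
     \det (principal U (fa E i)) `^ (alpha 0 i / 2 - #|pa E i|%:R / 2 - 1).
Proof.
move=> s0.
have p0 := det_leadmx_gt0 i; have f0 : 0 < \det (M i).
  by apply: det_symposdef_gt0; exact: symposdef_column_form.
rewrite /scale /residual; move: p0 f0; rewrite /M det_column_form// det_leadmx_column_form// npaE//.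
set P := \det (principal _ (pa _ _)); set F := \det (principal _ (fa _ _)).
move=> P0 F0; rewrite -/(shape i).
have -> : alpha 0 i / 2 - 1 = 2^-1 * #|pa E i|%:R + shape i by rewrite /shape; field.
have -> : alpha 0 i / 2 - #|pa E i|%:R / 2 - 3 / 2 = shape i - 2^-1 by rewrite /shape; field.
have -> : 2 `^ (2^-1 * #|pa E i|%:R + shape i) = Num.sqrt 2 ^+ #|pa E i| * 2 `^ shape i :> R.
  by rewrite powRD ?pnatr_eq0 ?implybT// powRrM powR12_sqrt// powR_mulrn ?sqrtr_ge0.
have -> : P `^ (shape i - 2^-1) = P `^ shape i / Num.sqrt P.
  by rewrite powRB ?(gt_eqF P0) ?implybT// powR12_sqrt ?(ltW P0).
rewrite powRN sqrtrM// exprMn.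
have -> : (F / P / 2) `^ shape i = F `^ shape i / (P `^ shape i) / (2 `^ shape i).
  rewrite !powRM ?mulr_ge0 ?invr_ge0 ?(ltW P0) ?(ltW F0)//.
  by congr (_ * _ * _); rewrite -powR_inv1 ?(ltW P0)// powRAC powR_inv1 ?powR_ge0.
by field; rewrite !gt_eqF ?powR_gt0 ?sqrtr_gt0.
Qed.

Lemma prode_gt0 (I : finType) (P : pred I) (f : I -> \bar R) :
  (forall j, (0 < f j)%E) -> (0 < \prod_(j | P j) f j)%E.
Proof. by move=> f0; elim/big_ind : _ => // x y; exact: mule_gt0. Qed.

(** An infinite factor is not compensated by the others, because these are
    positive. *)
Lemma zint_lty : (zint E U alpha < +oo)%E -> forall i, alpha 0 i > #|pa E i|%:R + 2.
Proof.
move=> + i; rewrite -shape_gt0; apply: contraTT; rewrite -leNgt => s0.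
have c20 j : 0 < residual j / 2 by rewrite divr_gt0 ?residual_gt0.
rewrite zint_prod (bigD1 i)//= integral_invgamma_infty// gt0_muley ?lte_fin ?scale_gt0//.
rewrite gt0_mulye ?ltxx//; apply: prode_gt0 => j.
by rewrite mule_gt0 ?lte_fin ?scale_gt0// integral_invgamma_gt0.
Qed.

Lemma zint_zval : (forall i, alpha 0 i > #|pa E i|%:R + 2) ->
  zint E U alpha = (zval E U alpha)%:E.
Proof.
move=> s0; rewrite zint_prod /zval -prodEFin; apply: eq_bigr => i _.
have c20 : 0 < residual i / 2 by rewrite divr_gt0 ?residual_gt0.
have si : 0 < shape i by rewrite shape_gt0.
by rewrite integral_invgamma// -EFinM zfactorE.
Qed.

End Assembly.

Theorem theorem7p2 (R : realType) (p : nat) (E : {set 'I_p * 'I_p})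
    (U : 'M[R]_p) (alpha : 'rV[R]_p) :
  acyclic E -> parent_ordering E -> symposdef U ->
  ((zint E U alpha < +oo)%E <->
     forall i : 'I_p, alpha 0 i > #|pa E i|%:R + 2) /\
  ((forall i : 'I_p, alpha 0 i > #|pa E i|%:R + 2) ->
     zint E U alpha = (zval E U alpha)%:E).
Proof.
move=> _ pE PU; split; last exact: zint_zval.
split; first exact: zint_lty.
by move=> h; rewrite zint_zval// ltry.
Qed.
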